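(* Let $R$ be a commutative ring with $1\neq 0$. Suppose that $R$ admits a 1-absorbing primary ideal that is not a primary ideal of $R$. Then $R$ is a quasilocal ring.
   Context: All rings are commutative with $1\neq 0$. A ring is quasilocal if it has exactly one maximal ideal. For an ideal $I$ of $R$, $\sqrt{I}=\{r\in R \mid r^{n}\in I \text{ for some integer } n\geq 1\}$. A proper ideal $I$ of $R$ is called a 1-absorbing primary ideal of $R$ if whenever $a,b,c\in R$ are nonunit elements with $abc\in I$, then $ab\in I$ or $c\in\sqrt{I}$. *)

(* Defs.v *)
From mathcomp Require Import all_boot all_algebra.
From mathcomp Require Import boolp classical_sets.

Set Implicit Arguments.
Unset Strict Implicit.
Unset Printing Implicit Defensive.

Import GRing.Theory.
Local Open Scope classical_set_scope.
Local Open Scope ring_scope.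

(* [idealr_closed] includes the condition 1 \notin I, hence "proper". *)
Definition is_proper_ideal (R : comNzRingType) (I : set R) : Prop :=
  idealr_closed [in I].

(* [GRing.unit] would require a [unitRingType] structure, i.e., a chosen
   inverse operation on R; this is invertibility in a bare commutative ring. *)
Definition is_unit (R : comNzRingType) (a : R) : Prop :=
  exists b : R, a * b = 1.

Definition radical (R : comNzRingType) (I : set R) : set R :=
  [set r | exists n : nat, (1 <= n)%N /\ I (r ^+ n)].

Definition primary_ideal (R : comNzRingType) (I : set R) : Prop :=
  is_proper_ideal I /\
  forall a b : R, I (a * b) -> I a \/ radical I b.

Definition one_absorbing_primary_ideal (R : comNzRingType) (I : set R) : Prop :=
  is_proper_ideal I /\
  forall a b c : R, ~ is_unit a -> ~ is_unit b -> ~ is_unit c ->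
    I (a * b * c) -> I (a * b) \/ radical I c.

Definition maximal_ideal (R : comNzRingType) (M : set R) : Prop :=
  is_proper_ideal M /\
  forall J : set R, is_proper_ideal J -> M `<=` J -> J = M.

Definition quasilocal (R : comNzRingType) : Prop :=
  exists! M : set R, maximal_ideal M.

(* Main.v *)
(* If [a * b] lies in I but a is not in I and no power of b is, then for each
   nonunit w the product [w * a * b] lies in I, hence so does [w * a].  The
   colon ideal (I : a) is thus a proper ideal containing all nonunits, so it
   is the unique maximal ideal. *)
Require Import Defs.
From mathcomp Require Import all_boot all_algebra.
From mathcomp Require Import boolp classical_sets.

Set Implicit Arguments.
Unset Strict Implicit.
Unset Printing Implicit Defensive.

Import GRing.Theory.
Local Open Scope classical_set_scope.
Local Open Scope ring_scope.

(** Trades the boolean membership [[in I]] used by [idealr_closed] for [Prop] membership, so that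
    [I] can be applied directly. *)
Lemma is_proper_idealP (R : comNzRingType) (I : set R) :
  is_proper_ideal I <->
  [/\ I 0, ~ I 1 & forall c x y : R, I x -> I y -> I (c * x + y)].
Proof.
split=> [[I0 I1 Ilin] | [I0 I1 Ilin]].
  split; first exact: set_mem I0.
    by move=> /mem_set I1'; rewrite I1' in I1.
  by move=> c x y /mem_set Ix /mem_set Iy; apply: set_mem; apply: Ilin.
split; first exact: mem_set.
  by apply/negP => /set_mem.
by move=> c x y /set_mem Ix /set_mem Iy; apply: mem_set; apply: Ilin.
Qed.

Lemma proper_ideal_mull (R : comNzRingType) (I : set R) (c x : R) :
  is_proper_ideal I -> I x -> I (c * x).
Proof.
by case/is_proper_idealP => I0 _ Ilin Ix; rewrite -[c * x]addr0; apply: Ilin.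
Qed.

Lemma proper_ideal_nonunit (R : comNzRingType) (I : set R) (x : R) :
  is_proper_ideal I -> I x -> ~ is_unit x.
Proof.
move=> Ip Ix [y xy1]; have /is_proper_idealP[_ I1 _] := Ip.
by apply: I1; rewrite -xy1 mulrC; apply: proper_ideal_mull.
Qed.

(** A proper ideal consists of nonunits, so [M] contains every proper ideal; it is therefore
    maximal, and any maximal ideal equals it. *)
Lemma quasilocal_nonunits (R : comNzRingType) (M : set R) :
  is_proper_ideal M -> (forall x : R, ~ is_unit x -> M x) -> quasilocal R.
Proof.
move=> Mp Mnu.
have subM (J : set R) : is_proper_ideal J -> J `<=` M.
  by move=> Jp x Jx; apply: Mnu; apply: proper_ideal_nonunit Jp Jx.
exists M; split; last by move=> N [Np]; apply; last exact: subM.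
by split=> // J Jp MJ; apply/seteqP; split=> //; apply: subM.
Qed.

(** The hypothesis [~ I a] says exactly that 1 is outside the colon ideal. *)
Lemma colon_proper_ideal (R : comNzRingType) (I : set R) (a : R) :
  is_proper_ideal I -> ~ I a -> is_proper_ideal [set x | I (x * a)].
Proof.
case/is_proper_idealP => I0 _ Ilin nIa; apply/is_proper_idealP; split=> /=.
- by rewrite mul0r.
- by rewrite mul1r.
- by move=> c x y Ix Iy; rewrite mulrDl -mulrA; apply: Ilin.
Qed.

Lemma not_primary_witness (R : comNzRingType) (I : set R) :
  is_proper_ideal I -> ~ primary_ideal I ->
  exists a b : R, [/\ I (a * b), ~ I a & ~ radical I b].
Proof.
move=> Ip nprim; apply: contrapT => nex; apply: nprim; split=> // a b Iab.
apply: contrapT => /not_orP[nIa nrb]; apply: nex.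
by exists a, b.
Qed.

Theorem theorem3 (R : comNzRingType) :
  (exists I : set R, one_absorbing_primary_ideal I /\ ~ primary_ideal I) ->
  quasilocal R.
Proof.
case=> I [[Ip abs] /(not_primary_witness Ip)[a [b [Iab nIa nrb]]]].
(* [abs] applies to nonunits only. If [a] had an inverse [c], then [b = c * (a * b)] would lie in
   [I], hence in its radical. *)
have anu : ~ is_unit a.
  case=> c ac1; apply: nrb; exists 1%N; split=> //.
  rewrite expr1 -[b]mul1r -ac1 [a * c]mulrC -mulrA.
  exact: proper_ideal_mull.
(* Symmetrically, an inverse [c] of [b] would put [a = c * (a * b)] in [I]. *)
have bnu : ~ is_unit b.
  case=> c bc1; apply: nIa; rewrite -[a]mulr1 -bc1 mulrA mulrC.
  exact: proper_ideal_mull.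
apply: (quasilocal_nonunits (colon_proper_ideal Ip nIa)) => w wnu /=.
have /(abs w a b wnu anu bnu)[] // : I (w * a * b).
by rewrite -mulrA; apply: proper_ideal_mull.
Qed.
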